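(* For each integer $d \ge 3$, there exist infinitely many (pairwise non-isomorphic) $d$-regular nut graphs.
   Context: All graphs are finite and simple. A nut graph is a graph $G$ whose adjacency matrix $A(G)$ has nullity exactly $1$ (i.e. $0$ is an eigenvalue of multiplicity one) and such that a non-zero vector spanning $\ker A(G)$ has no zero entries. *)

(* Defs.v *)
From HB Require Import structures.
From mathcomp Require Import all_boot all_order all_algebra.
From mathcomp Require Import reals.

Set Implicit Arguments.
Unset Strict Implicit.
Unset Printing Implicit Defensive.

Import GRing.Theory.
Local Open Scope ring_scope.

Record sgraph := SGraph {
  vertex :> finType;
  adj : rel vertex;
  adj_sym : symmetric adj;
  adj_irrefl : irreflexive adj }.

Definition isomorphic (G H : sgraph) : Prop :=
  exists2 f : G -> H, bijective f & forall x y, adj (f x) (f y) = adj x y.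

Definition regular (d : nat) (G : sgraph) : Prop :=
  forall x : G, #|[set y | adj x y]| = d.

Definition adjmx (R : realType) (G : sgraph) : 'M[R]_#|G| :=
  \matrix_(i, j) (adj (enum_val i) (enum_val j))%:R.

(* [kermx] is the kernel for the action on row vectors; it is the transpose of
   the usual kernel since [adjmx R G] is symmetric. *)
Definition nullity (R : realType) (G : sgraph) : nat :=
  \rank (kermx (adjmx R G)).

(* When the nullity is 1, the vectors spanning the kernel are exactly the
   non-zero vectors of the kernel. *)
Definition nut_graph (R : realType) (G : sgraph) : Prop :=
  nullity R G = 1%N /\
  forall v : 'rV[R]_#|G|, v *m adjmx R G = 0 -> v != 0 ->
    forall i, v 0 i != 0.

(* Main.v *)
(** A d-regular multigraph, possibly with loops, is presented by d ports at every
vertex and a fixed-point-free involution matching the ports. Replace every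
vertex v by v itself and vertices p_i, q_i for each port i, where v ~ q_i,
q_i ~ p_j for j <> i, and p_i is joined to the p-vertex of the matched port.
The result is a simple d-regular graph. In a null vector x of it, the equations
at the q_i force all p_i to share one value a(v), with x(v) = (1 - d) a(v); those
at v and at the p_i force x(q_i) to be the value of a at the i-th neighbour of v
and a to be a null vector of the multigraph. So this expansion preserves nullity
one and the absence of zero entries, and can be iterated. It remains to exhibit,
for each d >= 3, one d-regular multigraph with these two properties: two adjacent
centres, each with d - 1 leaves carrying as many loops as possible, plus one edge
to the corresponding leaf on the other side if d is even. *)

Require Import Defs.
From HB Require Import structures.
From mathcomp Require Import all_boot all_order all_algebra.
From mathcomp Require Import reals.
From mathcomp Require Import ring lra zify.

Set Implicit Arguments.
Unset Strict Implicit.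
Unset Printing Implicit Defensive.

Import Order.TTheory GRing.Theory Num.Theory.
Local Open Scope ring_scope.

(** * Port graphs and their null vectors *)

Record portgraph (P : finType) := PortGraph {
  node : finType;
  flip : node * P -> node * P;
  flipK : involutive flip;
  flip_neq : forall x, flip x != x }.

Definition nbr (P : finType) (G : portgraph P) (v : node G) (i : P) : node G :=
  (flip (v, i)).1.

Definition simple (P : finType) (G : portgraph P) : Prop :=
  forall v : node G, injective (nbr v) /\ forall i, nbr v i != v.

(** Summing over ports counts parallel edges with multiplicity and a loop twice, as it occupies two
    ports. *)
Definition null_fun (R : pzRingType) (P : finType) (G : portgraph P)
    (x : node G -> R) : Prop :=
  forall v, \sum_i x (nbr v i) = 0.

Definition port_nut (R : pzRingType) (P : finType) (G : portgraph P) : Prop :=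
  exists x : node G -> R,
    [/\ null_fun x, forall v, x v != 0
      & forall y, null_fun y -> exists c, forall v, y v = c * x v].

(** * From simple port graphs to adjacency matrices *)

Section Underlying.

Variables (P : finType) (G : portgraph P).

Definition under_adj : rel (node G) :=
  fun u v => (u != v) && [exists i, nbr u i == v].

Lemma under_adj_sym : symmetric under_adj.
Proof.
suff H u v : under_adj u v -> under_adj v u by move=> u v; apply/idP/idP => /H.
move=> /andP[uv /existsP[i /eqP nui]]; rewrite /under_adj eq_sym uv /=.
apply/existsP; exists (flip (u, i)).2.
by rewrite /nbr -{1}nui /nbr -surjective_pairing flipK.
Qed.

Lemma under_adj_irrefl : irreflexive under_adj.
Proof. by move=> u; rewrite /under_adj eqxx. Qed.

Definition underlying : sgraph := SGraph under_adj_sym under_adj_irrefl.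

Hypothesis simpleG : simple G.

Lemma adj_underlyingE (u v : underlying) :
  adj u v = (v \in [set nbr u i | i : P]).
Proof.
rewrite /= /under_adj; apply/andP/imsetP => [[_ /existsP[i /eqP <-]]|[i _ ->]].
  by exists i.
by rewrite eq_sym (simpleG u).2; split=> //; apply/existsP; exists i.
Qed.

Lemma underlying_regular : regular #|P| underlying.
Proof.
move=> u; rewrite (_ : [set y | adj u y] = [set nbr u i | i : P]).
  by rewrite card_imset //; exact: (simpleG u).1.
by apply/setP => v; rewrite inE adj_underlyingE.
Qed.

Variable R : realType.

(** Simplicity makes the ports of [u] list its neighbours without repetition. *)
Lemma mul_adjmx_underlying (x : underlying -> R) u :
  ((\row_i x (enum_val i)) *m adjmx R underlying) 0 (enum_rank u) =
  \sum_i x (nbr u i).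
Proof.
rewrite mxE (eq_bigr (fun i => x (enum_val i) *+ adj u (enum_val i))); last first.
  by move=> i _; rewrite !mxE enum_rankK adj_sym mulr_natr.
rewrite -(reindex (@enum_val underlying predT) (P := predT)
  (F := fun v => x v *+ adj u v)) /=; last first.
  by exists enum_rank => i _; rewrite ?enum_valK ?enum_rankK.
transitivity (\sum_(v in [set nbr u i | i : P]) x v).
  rewrite [RHS]big_mkcond; apply: eq_bigr => v _ /=.
  by rewrite -adj_underlyingE /=; case: under_adj.
by rewrite big_imset //= => i j _ _; exact: (simpleG u).1.
Qed.

Lemma underlying_nut :
  (0 < #|node G|)%N -> port_nut R G -> nut_graph R underlying.
Proof.
move=> /card_gt0P[u _] [x [x_null x_neq0 x_span]].
pose X : 'rV[R]_#|underlying| := \row_i x (enum_val i).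
have kerP (v : 'rV[R]_#|underlying|) :
    v *m adjmx R underlying = 0 -> exists c, v = c *: X.
  move=> v0; have [|c cE] := x_span (fun u => v 0 (enum_rank u)).
    move=> w; rewrite -(mul_adjmx_underlying (fun u => v 0 (enum_rank u))).
    rewrite (_ : \row_i _ = v) ?v0 ?mxE //.
    by apply/rowP => i; rewrite mxE enum_valK.
  by exists c; apply/rowP => i; rewrite !mxE -cE enum_valK.
have X0 : X *m adjmx R underlying = 0.
  by apply/rowP => i; rewrite -(enum_valK i) mul_adjmx_underlying x_null mxE.
split.
  (* The kernel matrix and [X] have the same row space, and [X] is non-zero because its entry at [u]
     is. *)
  have -> : nullity R underlying = \rank X.
    apply: eqmx_rank; apply/andP; split; last exact/sub_kermxP.
    apply/row_subP => i; have [|c ->] := kerP (row i (kermx (adjmx R underlying))).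
      by rewrite -row_mul mulmx_ker row0.
    exact: scalemx_sub.
  rewrite rank_rV; case: eqP => // /rowP/(_ (enum_rank (u : underlying))).
  by rewrite !mxE enum_rankK => /eqP; rewrite (negPf (x_neq0 u)).
move=> v /kerP[c ->] cX i; rewrite !mxE mulf_neq0 //.
by apply: contraNneq cX => ->; rewrite scale0r.
Qed.

End Underlying.

(** * The expansion and its null vectors *)

Section Expand.

Variables (P : finType) (G : portgraph P).

(* The vertex [v] is kept as [inl v]; the port [i] of [v] gives rise to two
   vertices, [inr (v, i, true)] which inherits the link of that port and
   [inr (v, i, false)] which is linked to [v] and to the [inr (v, j, true)]
   with [j != i]. *)
Definition expand_node : finType := (node G + node G * P * bool)%type.

Definition expand_flip (z : expand_node * P) : expand_node * P :=
  let: (w, j) := z in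
  match w with
  | inl v => (inr (v, j, false), j)
  | inr (v, i, true) =>
      if j == i then (inr (flip (v, i), true), (flip (v, i)).2)
      else (inr (v, j, false), i)
  | inr (v, i, false) =>
      if j == i then (inl v, i) else (inr (v, j, true), i)
  end.

Lemma expand_flipK : involutive expand_flip.
Proof.
move=> [[v|[[v i] []]] j] /=; rewrite ?eqxx //.
  case: (eqVneq j i) => [->|ji] /=; last by rewrite eq_sym (negPf ji).
  case E: (flip (v, i)) => [w k] /=.
  by rewrite eqxx -E flipK.
by case: (eqVneq j i) => [->|ji] //=; rewrite eq_sym (negPf ji).
Qed.

Lemma expand_flip_neq z : expand_flip z != z.
Proof.
apply/eqP; case: z => [[v|[[v i] []]] j] //=; case: ifP => // _ [].
by move=> e _; have := flip_neq (v, i); rewrite e eqxx.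
Qed.

Definition expand : portgraph P := PortGraph expand_flipK expand_flip_neq.

(** Distinct ports of [G] receive distinct vertices, which pulls loops and parallel edges of [G]
    apart; [flip_neq] prevents an inherited link from being a loop. *)
Lemma expand_simple : simple expand.
Proof.
move=> [v|[[v i] b]]; rewrite /nbr /=; split.
- by move=> j k [].
- by [].
- move=> j k; case: b.
    by do 2 case: eqVneq => [->|?] //=; case.
  by do 2 case: eqVneq => [->|?] //=; case.
- move=> j; apply/eqP; case: b; case: eqVneq => //= _ [].
  by move=> e; have := flip_neq (v, i); rewrite e eqxx.
Qed.

Lemma card_expand : (0 < #|P|)%N -> (0 < #|node G|)%N ->
  (#|node G| < #|node expand|)%N.
Proof.
move=> P0 V0; rewrite card_sum !card_prod card_bool -[ltnLHS]addn0 ltn_add2l.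
by rewrite !muln_gt0 P0 V0.
Qed.

Variable R : numFieldType.

Definition expand_fun (a : node G -> R) (w : node expand) : R :=
  match w with
  | inl v => (1 - #|P|%:R) * a v
  | inr (v, i, true) => a v
  | inr (v, i, false) => a (nbr v i)
  end.

Lemma sum_replace (F : P -> R) i A :
  \sum_j (if j == i then A else F j) = A + (\sum_j F j - F i).
Proof.
rewrite (bigD1 i) //= eqxx; congr (_ + _).
rewrite [in RHS](bigD1 i) //= [F i + _]addrC addrK.
by apply: eq_bigr => j /negPf ->.
Qed.

(** The three families are the equations at [v], at the q_i and at the p_i. Subtracting the term of
    index [i] accounts for the one port that leaves the block between p- and q-vertices. *)
Lemma null_expandP (y : node expand -> R) :
  null_fun y <->
  [/\ forall v, \sum_i y (inr (v, i, false)) = 0,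
      forall v i, y (inl v) +
        (\sum_j y (inr (v, j, true)) - y (inr (v, i, true))) = 0
    & forall v i, y (inr (flip (v, i), true)) +
        (\sum_j y (inr (v, j, false)) - y (inr (v, i, false))) = 0].
Proof.
have sumE v i b : \sum_j y (nbr (inr (v, i, b) : node expand) j) =
  (if b then y (inr (flip (v, i), true)) else y (inl v)) +
  (\sum_j y (inr (v, j, ~~ b)) - y (inr (v, i, ~~ b))).
  rewrite -(sum_replace (fun j => y (inr (v, j, ~~ b)))).
  by apply: eq_bigr => j _; rewrite /nbr /=; case: b; case: ifP.
split=> [y0|[y1 y2 y3] [v|[[v i] []]]].
- split=> [v|v i|v i]; first exact: y0 (inl v).
    by have := y0 (inr (v, i, false)); rewrite sumE.
  by have := y0 (inr (v, i, true)); rewrite sumE.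
- exact: y1.
- by rewrite sumE y3.
- by rewrite sumE y2.
Qed.

Lemma null_expand_fun (a : node G -> R) : null_fun a -> null_fun (expand_fun a).
Proof.
move=> a0; apply/null_expandP; split=> [v|v i|v i] /=; first exact: a0.
  rewrite sumr_const -mulr_natl; ring.
by rewrite a0 /nbr; case: (flip _) => w k; ring.
Qed.

Lemma null_expand_inv (y : node expand -> R) :
  null_fun y -> exists2 a, null_fun a & y =1 expand_fun a.
Proof.
move=> /null_expandP[y1 y2 y3].
(* The equation at q_i says that p_i has this value, which does not depend on [i]. *)
pose a v := y (inl v) + \sum_j y (inr (v, j, true)).
have ya v i : y (inr (v, i, true)) = a v.
  by apply/eqP; rewrite eq_sym -subr_eq0 -addrA y2.
have yq v i : y (inr (v, i, false)) = a (nbr v i).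
  have := y3 v i; rewrite y1 sub0r => /eqP; rewrite subr_eq0 => /eqP <-.
  by rewrite /nbr; case: (flip _) => w k; rewrite ya.
exists a => [v|].
  by rewrite -[RHS](y1 v); apply: eq_bigr => i _; rewrite yq.
move=> [v|[[v i] []]] //=.
(* Putting the common value of the p_j back into the definition of [a] yields the factor
   [1 - #|P|]. *)
have : a v = y (inl v) + a v *+ #|P|.
  by rewrite {1}/a (eq_bigr (fun=> a v)) ?sumr_const.
rewrite -mulr_natl => e; rewrite mulrBl mul1r {1}e; ring.
Qed.

Lemma expand_nut : (1 < #|P|)%N -> port_nut R G -> port_nut R expand.
Proof.
move=> P1 [x [x_null x_neq0 x_span]]; exists (expand_fun x); split.
- exact: null_expand_fun.
- move=> [v|[[v i] []]] //=; rewrite mulf_neq0 // subr_eq0 eq_sym.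
  by rewrite pnatr_eq1 neq_ltn P1 orbT.
- move=> y /null_expand_inv[a /x_span[c ac] ya]; exists c => w; rewrite ya.
  by case: w => [v|[[v i] []]] /=; rewrite ac // mulrCA.
Qed.

End Expand.

(** * The seed multigraph, of degree [m + 1] *)

Section Seed.

Variable m : nat.

(* [(b, None)] are the centres and [(b, Some i)] the leaves. Pairing the leaf
   ports by [rev_ord] yields the loops; the middle port, if any, is the fixed
   point, used for the edge to the other side. *)
Definition seed_flip (z : (bool * option 'I_m) * option 'I_m) :
    (bool * option 'I_m) * option 'I_m :=
  match z with
  | ((b, None), None) => ((~~ b, None), None)
  | ((b, None), Some i) => ((b, Some i), None)
  | ((b, Some i), None) => ((b, None), Some i)
  | ((b, Some i), Some j) =>
      ((if rev_ord j == j then ~~ b else b, Some i), Some (rev_ord j))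
  end.

Lemma seed_flipK : involutive seed_flip.
Proof.
move=> [[b [i|]] [j|]] //=; rewrite ?negbK // rev_ordK eq_sym.
by case: eqP; rewrite ?negbK.
Qed.

Lemma seed_flip_neq z : seed_flip z != z.
Proof.
apply/eqP; case: z => [[b [i|]] [j|]] //=; last by case: b.
by case: eqP => [_ /(congr1 (fst \o fst))|rj /(congr1 snd) /= /Some_inj //]; case: b.
Qed.

Definition seed : portgraph (option 'I_m) :=
  PortGraph seed_flipK seed_flip_neq.

Variable R : realFieldType.

Lemma sum_option (F : option 'I_m -> R) :
  \sum_o F o = F None + \sum_i F (Some i).
Proof.
rewrite (bigD1 None) //=; congr (_ + _).
rewrite (reindex_omap Some id) => [|[]] //.
by apply: eq_bigl => i; rewrite /= eqxx.
Qed.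

(** These count ports at one leaf: [cross] is the parity of [m], and each loop contributes 2 to
    [loops]. *)
Let cross := #|[pred j : 'I_m | rev_ord j == j]|.
Let loops := #|[pred j : 'I_m | rev_ord j != j]|.

Lemma null_seedP (y : node seed -> R) :
  null_fun y <->
  (forall b, y (~~ b, None) + \sum_i y (b, Some i) = 0) /\
  (forall b i, y (b, None) +
     (y (~~ b, Some i) *+ cross + y (b, Some i) *+ loops) = 0).
Proof.
have cE b : \sum_o y (nbr ((b, None) : node seed) o) =
    y (~~ b, None) + \sum_i y (b, Some i) by rewrite sum_option.
have lE b i : \sum_o y (nbr ((b, Some i) : node seed) o) =
    y (b, None) + (y (~~ b, Some i) *+ cross + y (b, Some i) *+ loops).
  rewrite sum_option; congr (_ + _).
  rewrite (bigID (fun j => rev_ord j == j)) /=; congr (_ + _).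
    rewrite -sumr_const; apply: eq_big => // j; rewrite /nbr /=.
    by move=> ->.
  rewrite -sumr_const; apply: eq_big => // j; rewrite /nbr /=.
  by move=> /negPf ->.
split=> [y0|[y1 y2] [b [i|]]]; last 2 first.
- by rewrite lE.
- by rewrite cE.
by split=> [b|b i]; rewrite -?cE -?lE y0.
Qed.

Lemma cross_loops : (cross + loops)%N = m.
Proof. by rewrite -[RHS](card_ord m) -(cardC [pred j : 'I_m | rev_ord j == j]). Qed.

(** Only a middle port can be fixed by [rev_ord], whereas the first and the last are swapped. *)
Lemma cross_lt_loops : (1 < m)%N -> (cross < loops)%N.
Proof.
move=> m1; apply: (@leq_ltn_trans 1).
  apply/card_le1P => i; rewrite inE => /eqP/(congr1 val) /= iE j.
  rewrite !inE; apply/eqP/eqP => [/(congr1 val) /= jE|->]; last exact/val_inj.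
  by apply: val_inj => /=; have := ltn_ord i; have := ltn_ord j; lia.
have m0 : (0 < m)%N by exact: ltnW.
have m2 : (m.-1 < m)%N by lia.
rewrite /loops (cardD1 (Ordinal m0)) (cardD1 (Ordinal m2)) !inE -!val_eqE /=.
have -> : (m - 1 != 0)%N by lia.
have -> : (m.-1 != 0)%N by lia.
by have -> : (m - m.-1.+1 != m.-1)%N by lia.
Qed.

(** The differences [D] and [e] between the two sides form the antisymmetric part of a null vector,
    which is shown to vanish. In the symmetric part, the leaf equations make every leaf [-1/m] times
    the centre. *)
Lemma seed_nut : (1 < m)%N -> port_nut R seed.
Proof.
move=> m1.
have m0 : m%:R != 0 :> R by rewrite pnatr_eq0; case: m m1.
pose x (w : node seed) : R := if w.2 is Some _ then 1 else - m%:R.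
exists x; split.
- apply/null_seedP; split=> [b|b i]; rewrite /x /=.
    by rewrite sumr_const card_ord addNr.
  by rewrite -mulrnDr cross_loops addNr.
- by move=> [b [i|]]; rewrite /x /= ?oner_neq0 ?oppr_eq0.
move=> y /null_seedP[yc yl].
pose D := y (true, None) - y (false, None).
pose e i := y (true, Some i) - y (false, Some i).
have eE i : e i * (loops%:R - cross%:R) = - D.
  have := yl true i; have := yl false i; rewrite /e /D /= -!(mulr_natr (y _)).
  by move: (loops%:R : R) (cross%:R : R) => l c; lra.
have De : \sum_i e i = D.
  by rewrite sumrB; have := yc true; have := yc false; rewrite /D /=; lra.
(* Summing [eE] over the leaves gives [(loops - cross) D = - m D]. *)
have D0 : D = 0.
  have : D * (loops%:R *+ 2) = 0.
    have : \sum_i e i * (loops%:R - cross%:R) = - D * m%:R.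
      by rewrite (eq_bigr _ (fun i _ => eE i)) sumr_const card_ord mulr_natr.
    rewrite -mulr_suml De -[in RHS]cross_loops natrD.
    by move: (loops%:R : R) (cross%:R : R) => l c; lra.
  move/eqP; rewrite mulf_eq0 mulrn_eq0 pnatr_eq0 /=.
  rewrite gtn_eqF ?orbF => [/eqP//|].
  exact: leq_ltn_trans (cross_lt_loops m1).
have e0 i : e i = 0.
  apply/eqP; have /eqP := eE i; rewrite D0 oppr0 mulf_eq0 => /orP[//|].
  by rewrite subr_eq0 eqr_nat gtn_eqF // cross_lt_loops.
have ycE b : y (b, None) = y (true, None).
  by case: b => //; apply/esym/eqP; rewrite -subr_eq0 -/D D0.
have ylE b b' i : y (b, Some i) = y (b', Some i).
  by have := e0 i; rewrite /e => /eqP; rewrite subr_eq0 => /eqP; case: b b' => -[].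
exists (- y (true, None) / m%:R) => -[b [i|]]; rewrite /x /=; last first.
  by rewrite ycE; field.
rewrite mulr1; apply: (canRL (mulfK m0)).
have := yl b i; rewrite ycE (ylE (~~ b) b) -mulrnDr cross_loops mulr_natr.
by move/eqP; rewrite addrC addr_eq0 => /eqP.
Qed.

End Seed.

(** * Iterated expansion and the infinite family *)

Lemma iter_expand_nut (R : numFieldType) (P : finType) (G : portgraph P) k :
  (1 < #|P|)%N -> port_nut R G -> port_nut R (iter k (@expand P) G).
Proof. by move=> P1 G_nut; elim: k => //= k; exact: expand_nut. Qed.

Lemma card_iter_expand (P : finType) (G : portgraph P) :
  (0 < #|P|)%N -> (0 < #|node G|)%N ->
  {homo (fun k => #|node (iter k (@expand P) G)|) : j k / (j < k)%N}.
Proof.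
move=> P0 G0; apply: homo_ltn => [|k]; first exact: ltn_trans.
apply: card_expand => //; elim: k => //= k IHk.
exact: ltn_trans (card_expand P0 IHk).
Qed.

Theorem theorem5 (R : realType) (d : nat) (hd : (3 <= d)%N) :
  exists F : nat -> sgraph,
    (forall k : nat, regular d (F k) /\ nut_graph R (F k)) /\
    (forall j k : nat, j <> k -> ~ isomorphic (F j) (F k)).
Proof.
case: d hd => // m m_gt1.
have PE : #|{: option 'I_m}| = m.+1 by rewrite card_option card_ord.
pose H k := iter k (@expand _) (seed m).
have P0 : (0 < #|{: option 'I_m}|)%N by rewrite PE.
have seed0 : (0 < #|node (seed m)|)%N by rewrite card_prod card_bool PE.
have H_lt := card_iter_expand P0 seed0.
(* The shift to [k.+1] ensures at least one expansion, since the seed has loops. Strictly growing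
   vertex counts exclude isomorphisms. *)
exists (fun k => underlying (H k.+1)); split=> [k|j k jk [f /bij_eq_card /= e _]].
  have simpleH : simple (H k.+1) by exact: expand_simple.
  split; first by rewrite -PE; exact: underlying_regular.
  apply: underlying_nut => //; first exact: leq_ltn_trans (H_lt 0 k.+1 _).
  by apply: iter_expand_nut; [rewrite PE ltnS ltnW|exact: seed_nut].
have [jk'|kj|//] := ltngtP j k.
  by have := H_lt j.+1 k.+1 jk'; rewrite [X in (X < _)%N]e ltnn.
by have := H_lt k.+1 j.+1 kj; rewrite [X in (_ < X)%N]e ltnn.
Qed.
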